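(* Let $G$ be an almost bipartite non-König-Egerváry graph with unique odd cycle $C$. Then: (i) $\mathrm{corona}(G)\cup N(\mathrm{core}(G))=V(G)$; (ii) if $G$ is connected, then $\mathrm{corona}(G)=V(C)\cup\left(\bigcup_{y\in V(C)}\mathrm{corona}(D_y-y)\right)$.
   Context: All graphs are finite, undirected, without loops or multiple edges. $N(A)=\bigcup_{v\in A}N(v)$ denotes the (open) neighborhood of a vertex set $A$. $\alpha(G)$ is the maximum size of an independent set, $\mu(G)$ the maximum size of a matching, $n(G)=|V(G)|$. $G$ is a König-Egerváry graph if $\alpha(G)+\mu(G)=n(G)$, and non-König-Egerváry otherwise. A cycle is a closed trail whose only repeated vertices are the first and the last. $G$ is almost bipartite if it has a unique odd cycle, denoted $C$, with vertex set $V(C)$ and edge set $E(C)$. For $y\in V(C)$, $D_y$ is the connected component containing $y$ of the graph $G-E(C)$ (obtained by deleting the edges of $C$); it is bipartite. $D_y-y$ is the graph obtained from $D_y$ by deleting the vertex $y$ (possibly the graph with no vertices, whose corona is empty). $\mathrm{core}(G)$ is the intersection, and $\mathrm{corona}(G)$ the union, of all maximum independent sets of $G$. *)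

(* Defs.v *)
From mathcomp Require Import all_boot.

Set Implicit Arguments.
Unset Strict Implicit.
Unset Printing Implicit Defensive.

(* A finite simple graph whose vertex set is a subset of T, so that a graph and
   the graphs obtained from it by deletions have vertices in the same type. *)
Record graph (T : finType) := Graph {
  vset : {set T};
  adj : rel T;
  adj_sym : symmetric adj;
  adj_irr : irreflexive adj;
  adj_vset : forall x y, adj x y -> x \in vset
}.

Section Invariants.
Variables (T : finType) (G : graph T).

Definition order_of := #|vset G|.

Definition nbh (A : {set T}) : {set T} := \bigcup_(v in A) [set w | adj G v w].

Definition independent (S : {set T}) : bool :=
  (S \subset vset G) && [forall x in S, forall y in S, ~~ adj G x y].

Definition alpha : nat := \max_(S : {set T} | independent S) #|S|.

Definition max_independent (S : {set T}) : bool :=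
  independent S && (#|S| == alpha).

(* set0 is independent, so the family of maximum independent sets is never
   empty and the default value setT of \bigcap plays no role. *)
Definition core : {set T} := \bigcap_(S : {set T} | max_independent S) S.

Definition corona : {set T} := \bigcup_(S : {set T} | max_independent S) S.

Definition edges : {set {set T}} :=
  [set [set p.1; p.2] | p : T * T & adj G p.1 p.2].

(* trivIset: the members of M are pairwise disjoint. *)
Definition matching (M : {set {set T}}) : bool := (M \subset edges) && trivIset M.

Definition mu : nat := \max_(M : {set {set T}} | matching M) #|M|.

Definition konig_egervary : Prop := alpha + mu = order_of.

Definition connected : Prop := {in vset G &, forall x y, connect (adj G) x y}.

(* The sequence of vertices met along the cycle, the first one not repeated at
   the end. A closed walk without repeated vertex in this sense is a trail iff
   it has at least 3 vertices: x, y, x uses the edge xy twice. *)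
Definition is_cycle (c : seq T) : Prop := ucycle (adj G) c /\ 2 < size c.

Definition odd_cycle (c : seq T) : Prop := is_cycle c /\ odd (size c).

End Invariants.

Definition cycle_vertices (T : finType) (c : seq T) : {set T} := [set x in c].

Definition cycle_edges (T : finType) (c : seq T) : {set {set T}} :=
  [set [set x; next c x] | x in c].

(* G is almost bipartite and c runs through its odd cycle. Cycles are compared
   as subgraphs, i.e. by their edge sets, since the same cycle is represented
   by several sequences (choice of first vertex and of direction). *)
Definition unique_odd_cycle (T : finType) (G : graph T) (c : seq T) : Prop :=
  odd_cycle G c /\
  (forall c', odd_cycle G c' -> cycle_edges c' = cycle_edges c).

Section Subgraphs.
Variables (T : finType) (G : graph T).

Section DeleteEdges.
Variable F : {set {set T}}.

Definition del_edges_adj : rel T :=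
  [rel x y | adj G x y && ([set x; y] \notin F)].

Lemma del_edges_sym : symmetric del_edges_adj.
Proof. by move=> x y; rewrite /del_edges_adj /= adj_sym setUC. Qed.

Lemma del_edges_irr : irreflexive del_edges_adj.
Proof. by move=> x; rewrite /del_edges_adj /= adj_irr. Qed.

Lemma del_edges_vset x y : del_edges_adj x y -> x \in vset G.
Proof. by case/andP=> /adj_vset. Qed.

Definition del_edges : graph T :=
  Graph del_edges_sym del_edges_irr del_edges_vset.

End DeleteEdges.

Section Induced.
Variable A : {set T}.

Definition induced_adj : rel T :=
  [rel x y | [&& x \in A, y \in A & adj G x y]].

Lemma induced_sym : symmetric induced_adj.
Proof. by move=> x y; rewrite /induced_adj /= adj_sym andbCA. Qed.

Lemma induced_irr : irreflexive induced_adj.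
Proof. by move=> x; rewrite /induced_adj /= adj_irr !andbF. Qed.

Lemma induced_vset x y : induced_adj x y -> x \in vset G :&: A.
Proof. by case/and3P=> xA _ /adj_vset xG; rewrite inE xG. Qed.

Definition induced : graph T := Graph induced_sym induced_irr induced_vset.

End Induced.

Definition del_vertex (v : T) : graph T := induced [set~ v].

Definition component (y : T) : graph T := induced [set z | connect (adj G) y z].

End Subgraphs.

(* D_y, for c the odd cycle of G. *)
Definition D_comp (T : finType) (G : graph T) (c : seq T) (y : T) : graph T :=
  component (del_edges G (cycle_edges c)) y.

(* Main.v *)
Require Import Defs.
From mathcomp Require Import all_boot zify.

Set Implicit Arguments.
Unset Strict Implicit.
Unset Printing Implicit Defensive.

(* Let H = G - V(C) and |C| = 2k + 1. Removing a vertex y of C leaves a bipartite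
   graph, and the components D_y of G - E(C) are disjoint. If some D_y satisfied
   alpha(D_y - y) = alpha(D_y), then a maximum independent set of D_y - y and one
   of G - D_y, together with maximum matchings of D_y and G - D_y, would by
   Konig's theorem make G a Konig-Egervary graph. Hence D_y - y has a maximum
   independent set without neighbours of y, and a maximum independent set of H
   can be rearranged on the sets D_y - y so as to avoid the neighbours of any
   prescribed vertices of C. So the maximum independent sets of G are made of k
   vertices of C and a maximum independent set of H, which gives
   corona(G) = V(C) u corona(H) and core(H) <= core(G); now (i) follows from the
   analogous covering property of the bipartite graph H, and (ii) from the fact
   that H is the disjoint union of the graphs D_y - y. *)

Definition proper_2coloring (T : Type) (e : rel T) (f : T -> bool) : Prop :=
  forall x y, e x y -> f x != f y.

Definition bipartite (T : finType) (G : graph T) : Prop :=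
  exists f, proper_2coloring (adj G) f.

(** * Independent sets, matchings and the bound [alpha G + mu G <= order_of G] *)

Section IndependentSets.
Variables (T : finType) (G : graph T).
Implicit Types (S A Z : {set T}) (M : {set {set T}}).

Lemma independentP S :
  reflect (S \subset vset G /\ {in S &, forall x y, ~~ adj G x y})
          (independent G S).
Proof.
apply: (iffP andP) => -[SV indS]; split=> //.
  by move=> x y xS yS; move/forall_inP: indS => /(_ x xS)/forall_inP/(_ y yS).
by apply/forall_inP=> x xS; apply/forall_inP=> y yS; apply: indS.
Qed.

Lemma independent0 : independent G set0.
Proof. by apply/independentP; split=> [|x y]; rewrite ?sub0set ?inE. Qed.

Lemma independent_sub S A : A \subset S -> independent G S -> independent G A.
Proof.
move=> AS /independentP[SV indS]; apply/independentP; split.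
  exact: subset_trans AS SV.
by move=> x y xA yA; apply: indS; apply: (subsetP AS).
Qed.

Lemma leq_alpha S : independent G S -> #|S| <= alpha G.
Proof.
by move=> indS; apply: (leq_bigmax_cond (F := fun S : {set T} => #|S|)).
Qed.

Lemma max_independent_exists : exists S, max_independent G S.
Proof.
have: 0 < #|[pred S | independent G S]|.
  by apply/card_gt0P; exists set0; rewrite inE independent0.
case/(eq_bigmax_cond (fun S : {set T} => #|S|)) => S indS eqS.
rewrite inE in indS; exists S.
by rewrite /max_independent indS /alpha -eqS eqxx.
Qed.

Lemma max_independentP S :
  reflect (independent G S /\ forall A, independent G A -> #|A| <= #|S|)
          (max_independent G S).
Proof.
apply: (iffP andP) => -[indS mS]; split=> //.
  by move=> A /leq_alpha; rewrite (eqP mS).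
have [A /andP[indA /eqP eqA]] := max_independent_exists.
by rewrite eqn_leq leq_alpha //= -eqA mS.
Qed.

Lemma mu_exists : exists2 M, matching G M & #|M| = mu G.
Proof.
have: 0 < #|[pred M | matching G M]|.
  apply/card_gt0P; exists set0; rewrite inE /matching sub0set.
  by apply/trivIsetP=> A B; rewrite inE.
by case/(eq_bigmax_cond (fun M : {set {set T}} => #|M|)) => M; exists M.
Qed.

Lemma leq_mu M : matching G M -> #|M| <= mu G.
Proof.
by move=> mM; apply: (leq_bigmax_cond (F := fun M : {set {set T}} => #|M|)).
Qed.

Lemma edgeP (e : {set T}) :
  reflect (exists x y, e = [set x; y] /\ adj G x y) (e \in edges G).
Proof.
apply: (iffP imsetP) => [[[x y]]|[x [y [-> xy]]]]; last by exists (x, y); rewrite ?inE.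
by rewrite inE => xy ->; exists x, y.
Qed.

Lemma coronaP x :
  reflect (exists2 S, max_independent G S & x \in S) (x \in corona G).
Proof. exact: bigcupP. Qed.

Lemma coreP x :
  reflect (forall S, max_independent G S -> x \in S) (x \in core G).
Proof. exact: bigcapP. Qed.

Lemma nbhP A x : reflect (exists2 v, v \in A & adj G v x) (x \in nbh G A).
Proof.
by apply: (iffP bigcupP) => -[v vA]; [rewrite inE|]; exists v; rewrite ?inE.
Qed.

(** A matching M covers 2|M| vertices, and an independent set S has at most one vertex in each edge
    of M, so the union of S and [cover M] has at least |S| + |M| vertices. *)
Lemma alpha_mu_leq : alpha G + mu G <= order_of G.
Proof.
have [S /andP[/independentP[SV indS] /eqP <-]] := max_independent_exists.
have [M /andP[ME tM] <-] := mu_exists.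
have cM : #|cover M| = #|M| + #|M|.
  rewrite -(eqP tM) (eq_bigr (fun=> 2)) ?sum_nat_const ?muln2 ?addnn // => e eM.
  have /edgeP[x [y [-> xy]]] := subsetP ME e eM.
  by rewrite cards2; case: eqP xy => // ->; rewrite adj_irr.
have cSM : #|S :&: cover M| <= #|M|.
  have -> : S :&: cover M = \bigcup_(e in M) (S :&: e).
    apply/setP=> x; rewrite inE; apply/andP/bigcupP => [[xS /bigcupP[e eM xe]]|].
      by exists e; rewrite // inE xS.
    by case=> e eM /setIP[xS xe]; split=> //; apply/bigcupP; exists e.
  rewrite -(sum1_card (mem M)); apply: (big_ind2 (fun (A : {set T}) m => #|A| <= m))
    => [|A m B n Am Bn|e eM].
  - by rewrite cards0.
  - by rewrite (leq_trans (leq_card_setU _ _)) // leq_add.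
  have /edgeP[x [y [-> xy]]] := subsetP ME e eM.
  apply/card_le1_eqP => u v /setIP[uS uxy] /setIP[vS vxy].
  case/set2P: uxy uS => ->; case/set2P: vxy vS => -> //.
    by move=> uS vS; have := indS _ _ uS vS; rewrite ?(adj_sym _ y) xy.
  by move=> uS vS; have := indS _ _ vS uS; rewrite ?(adj_sym _ y) xy.
have /subset_leq_card : S :\: cover M :|: cover M \subset vset G.
  rewrite subUset (subset_trans (subsetDl _ _) SV).
  apply/bigcupsP=> e eM; have /edgeP[x [y [-> xy]]] := subsetP ME e eM.
  by rewrite subUset !sub1set (adj_vset xy) (@adj_vset _ G y x) // adj_sym.
have -> : #|S :\: cover M :|: cover M| = #|S :\: cover M| + #|cover M|.
  apply/eqP; rewrite -(eqn_add2r #|(S :\: cover M) :&: cover M|) cardsUI.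
  by rewrite setIC setIDA [cover M :&: S]setIC -setIDA setDv setI0 cards0 addn0.
rewrite cM => le.
by have := cardsID (cover M) S; rewrite /order_of; lia.
Qed.

End IndependentSets.

(** * Induced subgraphs *)

Section Induced.
Variables (T : finType) (G : graph T).
Implicit Types (S A Z : {set T}) (M : {set {set T}}).

Lemma adj_induced A x y :
  adj (induced G A) x y = [&& x \in A, y \in A & adj G x y].
Proof. by []. Qed.

Lemma vset_induced A : vset (induced G A) = vset G :&: A.
Proof. by []. Qed.

Lemma independent_induced A S :
  independent (induced G A) S = independent G S && (S \subset A).
Proof.
apply/independentP/andP => [[]|[/independentP[SV indS] SA]].
  rewrite subsetI => /andP[SV SA] indS; split=> //; apply/independentP; split=> //.
  by move=> x y xS yS; move: (indS x y xS yS);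
    rewrite adj_induced (subsetP SA x xS) (subsetP SA y yS).
split=> [|x y xS yS]; first by rewrite subsetI SV.
by rewrite adj_induced negb_and negb_and indS ?orbT.
Qed.

Lemma bipartite_induced A : bipartite G -> bipartite (induced G A).
Proof. by case=> f fP; exists f => x y /and3P[_ _ /fP]. Qed.

Lemma matching_induced A M :
  matching (induced G A) M -> matching G M /\ cover M \subset A.
Proof.
case/andP=> ME tM; have eM e : e \in M -> e \in edges G /\ e \subset A.
  move/(subsetP ME)/edgeP => [x [y [-> /and3P[xA yA xy]]]].
  split; first by apply/edgeP; exists x, y.
  by rewrite subUset !sub1set xA.
split; last by apply/bigcupsP=> e /eM[].
by rewrite /matching tM andbT; apply/subsetP=> e /eM[].
Qed.

Lemma matching0 M : matching G M -> set0 \notin M.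
Proof.
case/andP=> ME _; apply/negP=> /(subsetP ME)/edgeP[x [y [/setP/(_ x)]]].
by rewrite !inE eqxx.
Qed.

Lemma mu_disjoint A Z : [disjoint A & Z] ->
  mu (induced G A) + mu (induced G Z) <= mu G.
Proof.
move=> dAZ; have [M mM <-] := mu_exists (induced G A).
have [N mN <-] := mu_exists (induced G Z).
have [/andP[ME tM] MA] := matching_induced mM.
have [/andP[NE tN] NZ] := matching_induced mN.
have dc : [disjoint cover M & cover N].
  exact: disjointWl MA (disjointWr NZ dAZ).
have dMN : M :&: N = set0.
  (* A common edge would lie in both of the disjoint covers, hence be empty. *)
  apply/setP=> e; rewrite !inE; apply/negP=> /andP[eM eN].
  have e0 : e = set0.
    apply/eqP; rewrite -subset0 -(disjoint_setI0 dc).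
    by rewrite subsetI !(bigcup_sup e).
  by have := matching0 (matching_induced mM).1; rewrite -e0 eM.
rewrite -[leqLHS]subn0 -(cards0 {set T}) -dMN -cardsU; apply: leq_mu.
by rewrite /matching subUset ME NE trivIsetU.
Qed.

End Induced.

(** * Bipartite graphs: maximum independent sets and König's theorem *)

Section Bipartite.
Variables (T : finType) (G : graph T).
Implicit Types (S A Z : {set T}).

(** The two choices of [b] give the join and the meet of a lattice on the independent sets of a
    bipartite graph. *)
Definition color_join (f : T -> bool) (b : bool) S A : {set T} :=
  [set x | if f x == b then x \in S :|: A else x \in S :&: A].

(** An edge inside the join would have one end in both sets and the other end in at least one of
    them, so it would lie inside [S] or inside [A]. *)
Lemma independent_color_join f b S A : proper_2coloring (adj G) f ->
  independent G S -> independent G A -> independent G (color_join f b S A).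
Proof.
move=> fP /independentP[SV indS] /independentP[AV indA].
apply/independentP; split=> [|x y].
  apply/subsetP=> x; rewrite inE; case: ifP => _; rewrite inE.
    by case/orP; apply: subsetP.
  by case/andP=> /(subsetP SV).
rewrite !inE => xJ yJ; apply/negP=> xy; move: xJ yJ (fP x y xy).
case: (f x == b) / eqP => [->|xb]; case: (f y == b) / eqP => [->|yb].
- by rewrite eqxx.
- move=> /orP[xS|xA] /andP[yS yA] _.
    by case/negP: (indS x y xS yS).
  by case/negP: (indA x y xA yA).
- move=> /andP[xS xA] /orP[yS|yA] _.
    by case/negP: (indS x y xS yS).
  by case/negP: (indA x y xA yA).
- by case: (f x) (f y) b xb yb => -[] [].
Qed.

(** The joins for [b] and [~~ b] have the same union and intersection as [S] and [A], so their sizes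
    add up to twice [alpha G]; neither exceeds [alpha G]. *)
Lemma max_independent_color_join f b S A : proper_2coloring (adj G) f ->
  max_independent G S -> max_independent G A ->
  max_independent G (color_join f b S A).
Proof.
move=> fP /andP[indS /eqP mS] /andP[indA /eqP mA].
have indJ b' := independent_color_join b' fP indS indA.
rewrite /max_independent indJ /=.
have eqU : color_join f b S A :|: color_join f (~~ b) S A = S :|: A.
  apply/setP=> x; rewrite !inE.
  by case: (f x); case: (x \in S); case: (x \in A); destruct b.
have eqI : color_join f b S A :&: color_join f (~~ b) S A = S :&: A.
  apply/setP=> x; rewrite !inE.
  by case: (f x); case: (x \in S); case: (x \in A); destruct b.
have := cardsUI (color_join f b S A) (color_join f (~~ b) S A).
rewrite eqU eqI cardsUI mS mA => e.
by have := leq_alpha (indJ b); have := leq_alpha (indJ (~~ b)); lia.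
Qed.

(* If every neighbour u of v were avoided by a maximum independent set that also
   avoids v, the join on the side of v of all these sets would miss v and all
   its neighbours, so v could be added to it. *)
Lemma bipartite_neighbor_cover v S0 : bipartite G -> v \in vset G ->
  max_independent G S0 -> v \notin S0 ->
  exists2 u, adj G v u &
    forall S, max_independent G S -> v \notin S -> u \in S.
Proof.
move=> [f fP] vG mS0 vS0.
case: (boolP [exists u, adj G v u &&
   [forall S : {set T}, max_independent G S ==> (v \notin S) ==> (u \in S)]]).
  case/existsP=> u /andP[vu /forallP uP]; exists u => // S mS vS.
  by move: (uP S); rewrite mS vS.
rewrite negb_exists => /forallP noU; exfalso.
have avoid (s : seq T) : all (adj G v) s -> exists S,
    [/\ max_independent G S, v \notin S & {in s, forall u, u \notin S}].
  elim: s => [_|u s IH /= /andP[vu sv]]; first by exists S0.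
  have [S [mS vS sS]] := IH sv.
  move: (noU u); rewrite vu /= negb_forall => /existsP[A].
  rewrite !negb_imply => /and3P[mA vA uA].
  (* Neighbours of [v] have the other colour, where the join is an intersection: the ones missed by
     [S] stay missed. *)
  have sidev w : adj G v w -> (w \in color_join f (f v) S A) = (w \in S :&: A).
    by move=> vw; rewrite inE eq_sym (negPf (fP _ _ vw)).
  exists (color_join f (f v) S A); split.
  - exact: max_independent_color_join.
  - by rewrite inE eqxx inE negb_or vS.
  move=> w; rewrite inE => /orP[/eqP->|ws].
    by rewrite sidev // inE negb_and uA orbT.
  by rewrite sidev ?(allP sv) // inE negb_and sS.
have [|S [mS vS sS]] := avoid (enum (adj G v)).
  by apply/allP=> u; rewrite mem_enum.
case/max_independentP: (mS) => /independentP[SV indS] maxS.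
suff /maxS : independent G (v |: S) by rewrite cardsU1 vS add1n ltnn.
have nvS u : u \in S -> ~~ adj G v u.
  by move=> uS; apply/negP=> vu; have := sS u; rewrite mem_enum uS => /(_ vu).
apply/independentP; split=> [|x y]; first by rewrite subUset sub1set vG.
rewrite !inE => /orP[/eqP->|xS] /orP[/eqP->|yS].
- by rewrite adj_irr.
- exact: nvS.
- by rewrite adj_sym nvS.
- exact: indS.
Qed.

(** Outside the corona, [v] is missed by all maximum independent sets, so the neighbour from
    [bipartite_neighbor_cover] belongs to all of them. *)
Lemma bipartite_corona v : bipartite G -> v \in vset G ->
  v \notin corona G -> exists2 u, u \in core G & adj G u v.
Proof.
move=> bG vG vC; have [S0 mS0] := max_independent_exists G.
have av S : max_independent G S -> v \notin S.
  by move=> mS; apply: contra vC => vS; apply/coronaP; exists S.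
have [u vu uP] := bipartite_neighbor_cover bG vG mS0 (av _ mS0).
by exists u; rewrite 1?adj_sym //; apply/coreP=> S mS; apply: uP; rewrite ?av.
Qed.

End Bipartite.

(** Induction on the order: delete the ends of an edge [v]-[u] that meets every maximum independent
    set. The order drops by two, [alpha] and [mu] by at least one each. *)
Lemma konig (T : finType) (G : graph T) :
  bipartite G -> order_of G <= alpha G + mu G.
Proof.
have [n] := ubnP (order_of G); elim: n G => // n IH G ltGn bG.
case: (boolP (independent G (vset G))) => [/leq_alpha|]; first by rewrite /order_of; lia.

have [[v w] /= vw _|noadj] := pickP (fun p : T * T => adj G p.1 p.2); last first.
  by case/independentP; split=> // x y _ _; rewrite (noadj (x, y)).
(* If [v] is in the core, any neighbour serves as [u]. *)
have [u vu uP] : exists2 u, adj G v u &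
    forall S, max_independent G S -> v \notin S -> u \in S.
  case: (boolP (v \in core G)) => [/coreP vC|].
    by exists w => // S /vC ->.
  case: (boolP [exists S : {set T}, max_independent G S && (v \notin S)]).
    case/existsP=> S /andP[mS vS] _.
    exact: bipartite_neighbor_cover bG (adj_vset vw) mS vS.
  rewrite negb_exists => /forallP allS /coreP[] S mS.
  by have := allS S; rewrite mS negbK.
pose G' := induced G (~: [set v; u]).
have uv : u != v by apply: contraTneq vu => ->; rewrite adj_irr.
have ordG : order_of G = (order_of G').+2.
  rewrite /order_of vset_induced -setDE (cardsD1 v) (adj_vset vu).
  rewrite (cardsD1 u (_ :\ v)) !inE uv (@adj_vset _ G u v) 1?adj_sym //.
  by rewrite /= setDDl.
have alphaG : alpha G' < alpha G.
  have [S /andP[]] := max_independent_exists G'.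
  rewrite independent_induced => /andP[indS /subsetP SA] /eqP <-.
  rewrite ltn_neqAle leq_alpha // andbT; apply/negP=> aS.
  have mS : max_independent G S by rewrite /max_independent indS.
  have vS : v \notin S by apply/negP=> /SA; rewrite !inE eqxx.
  by have /SA := uP S mS vS; rewrite !inE eqxx orbT.
have muG : mu G' < mu G.
  have [M mM <-] := mu_exists G'.
  have [mMG /subsetP MA] := matching_induced mM.
  have [|] := trivIsetU1 _ (andP mMG).2 (matching0 mMG) (A := [set v; u]).
    move=> e eM; rewrite disjoints_subset; apply/subsetP=> x xvu.
    rewrite inE; apply/negP=> xe; have /MA : x \in cover M by apply/bigcupP; exists e.
    by rewrite inE xvu.
  (* The 1 is read as the boolean [[set v; u] \notin M], the form in which it occurs in
     [cardsU1]. *)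
  move=> tM nM; rewrite -add1n -[1 + _]/((true : nat) + _) -nM -cardsU1.
  apply: leq_mu; rewrite /matching tM subUset (andP mMG).1 sub1set !andbT.
  by apply/edgeP; exists v, u.
have := IH G'; rewrite -ltnS ordG in ltGn *.
by move/(_ _ (bipartite_induced _ bG)); lia.
Qed.

(** * Odd cycles and 2-colourings *)

Section OddCycles.
Variables (T : finType).
Implicit Types (G : graph T) (F : {set {set T}}) (c p : seq T).

Lemma set2_eq (x y u v : T) :
  [set x; y] = [set u; v] -> x = u /\ y = v \/ x = v /\ y = u.
Proof.
move=> E; have : x \in [set u; v] by rewrite -E set21.
have : y \in [set u; v] by rewrite -E set22.
have : u \in [set x; y] by rewrite E set21.
have : v \in [set x; y] by rewrite E set22.
by do 4![case/set2P => ?]; subst; auto.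
Qed.

Lemma adj_del_edges G F x y :
  adj (del_edges G F) x y = adj G x y && ([set x; y] \notin F).
Proof. by []. Qed.

Lemma odd_cycle_del_edges G F c : odd_cycle (del_edges G F) c -> odd_cycle G c.
Proof.
case=> [[/andP[cc uc] sc] oc]; do 2![split=> //].
by rewrite /ucycle uc andbT; apply: sub_cycle cc => x y /andP[].
Qed.

Lemma proper_2coloring_path (e : rel T) (f : T -> bool) x p :
  proper_2coloring e f -> path e x p -> f (last x p) = f x (+) odd (size p).
Proof.
move=> fP; elim: p x => [|y p IH] x /=; first by rewrite addbF.
by case/andP=> /fP xy /IH->; case: (f x) (f y) (odd _) xy => -[] [].
Qed.

(** Induction on the number of adjacent pairs: 2-colour the graph without an edge [u]-[v]. If both
    ends get the same colour, a path joining them would be even and close up to an odd cycle; so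
    they lie in different components, and the colours are flipped on that of [u]. *)
Lemma no_odd_cycle_bipartite G : (forall c, ~ odd_cycle G c) -> bipartite G.
Proof.
have [n] := ubnP #|[set p : T * T | adj G p.1 p.2]|.
elim: n G => // n IH G ltn noC.
have [[u v] /= uv|noadj] := pickP (fun p : T * T => adj G p.1 p.2); last first.
  by exists xpred0 => x y xy; have := noadj (x, y); rewrite /= xy.
pose G' := del_edges G [set [set u; v]].
have G'E x y : adj G x y -> [\/ adj G' x y, x = u /\ y = v | x = v /\ y = u].
  move=> xy; case: (eqVneq [set x; y] [set u; v]) => [/set2_eq[]|nxy].
  - exact: Or32.
  - exact: Or33.
  by apply: Or31; rewrite adj_del_edges xy inE.
have [|c /odd_cycle_del_edges/noC //|f fP] := IH G'.
  rewrite ltnS in ltn; apply: leq_trans ltn; apply: proper_card; apply/properP; split.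
    by apply/subsetP=> p; rewrite !inE => /andP[].
  by exists (u, v); rewrite inE // adj_del_edges /= set11 andbF.
case: (eqVneq (f u) (f v)) => [fuv|nfuv]; last first.
  exists f => x y /G'E[/fP //|[-> ->]//|[-> ->]].
  by rewrite eq_sym.
have ncuv : ~~ connect (adj G') u v.
  apply/negP=> /connectP[p pP lp]; move: lp; case/shortenP: pP => q qP uq _ lq.
  have := proper_2coloring_path fP qP; rewrite -lq -fuv => oq.
  have {}oq : ~~ odd (size q) by case: (f u) (odd _) oq => -[].
  apply: (noC (u :: q)); split=> //; split; last first.
    case: q {qP uq} lq oq => [/= vu|? []//].
    by move: uv; rewrite vu adj_irr.
  rewrite /ucycle uq andbT /= rcons_path -lq adj_sym uv andbT.
  by apply: sub_path qP => x y /andP[].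
exists (fun x => f x (+) connect (adj G') u x) => x y /G'E[xy|[-> ->]|[-> ->]].
- have sG' : connect_sym (adj G') by apply: sym_connect_sym; apply: adj_sym.
  rewrite (same_connect_r sG' (connect1 xy)).
  by have := fP _ _ xy; case: (f x) (f y) => -[] //; case: (connect _ _ _).
- by rewrite connect0 (negPf ncuv) fuv; case: (f v).
- by rewrite connect0 (negPf ncuv) fuv; case: (f v).
Qed.

(** Allows any vertex of the cycle to be taken as the first one. *)
Lemma unique_odd_cycle_rot G c i :
  unique_odd_cycle G c -> unique_odd_cycle G (rot i c).
Proof.
case=> [[[ucc sc] oc] uniC]; split.
  by rewrite /odd_cycle /is_cycle rot_ucycle size_rot.
move=> c' /uniC->; have uc := ucycle_uniq ucc.
apply/setP=> e; apply/imsetP/imsetP => -[x]; rewrite ?mem_rot => xc ->;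
  by exists x; rewrite ?mem_rot ?next_rot.
Qed.

Lemma next_last_head x p : uniq (x :: p) -> next (x :: p) (last x p) = x.
Proof.
by move=> up; rewrite next_nth mem_last index_last // nth_default.
Qed.

(** Every odd cycle uses the closing edge, so deleting it leaves a bipartite graph; the rest of the
    cycle is a path, along which colours alternate. *)
Lemma unique_odd_cycle_2coloring G x0 p : unique_odd_cycle G (x0 :: p) ->
  exists f, proper_2coloring (adj (del_edges G [set [set last x0 p; x0]])) f /\
    forall j, j <= size p -> f (nth x0 (x0 :: p) j) = f x0 (+) odd j.
Proof.
case=> [[[/andP[cc uc] sc] oc] uniC].
have [c' oc'|f fP] := @no_odd_cycle_bipartite (del_edges G [set [set last x0 p; x0]]).
  have : [set last x0 p; x0] \in cycle_edges (x0 :: p).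
    by apply/imsetP; exists (last x0 p); rewrite ?mem_last // next_last_head.
  rewrite -(uniC c' (odd_cycle_del_edges oc')) => /imsetP[x xc' eqx].
  have [[/andP[cc' _] _] _] := oc'; have := next_cycle cc' xc'.
  by rewrite adj_del_edges -eqx inE eqxx andbF.
exists f; split=> //; elim=> [|j IH] ltj; first by rewrite addbF.
have /= := cc; rewrite rcons_path => /andP[/(pathP x0)/(_ j ltj) jj1 _].
suff /fP : adj (del_edges G [set [set last x0 p; x0]])
    (nth x0 (x0 :: p) j) (nth x0 (x0 :: p) j.+1).
  rewrite IH 1?ltnW //= addbN; set b := _ (+) _; by case: b; case: (f _).
rewrite adj_del_edges jj1 inE; case/andP: uc => x0p up.
apply/eqP=> /set2_eq[[_ /= jx0]|[]]; first by rewrite -jx0 mem_nth in x0p.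
case: j {IH jj1} ltj => [|j] /= ltj; last first.
  by move=> jx0 _; rewrite -jx0 mem_nth ?(ltnW ltj) in x0p.
(* The first edge is the closing one only if [p] has a single vertex, against
   [2 < size (x0 :: p)]. *)
move: sc; rewrite -nth_last /= => sc _ /eqP.
rewrite nth_uniq ?prednK // => /eqP; lia.
Qed.

End OddCycles.

(** * Exchanging independent sets on a union of components *)

Section ClosedSets.
Variables (T : finType) (G : graph T) (Z : {set T}).
Hypothesis clZ : closed (adj G) Z.
Implicit Types (S A : {set T}).

Lemma independent_swap S A : independent G S -> independent G A -> A \subset Z ->
  independent G (S :\: Z :|: A).
Proof.
move=> /independentP[SV indS] /independentP[AV indA] /subsetP AZ.
apply/independentP; split=> [|x y].
  by rewrite subUset AV (subset_trans (subsetDl _ _) SV).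
rewrite !inE => /orP[/andP[xZ xS]|xA] /orP[/andP[yZ yS]|yA].
- exact: indS.
- by apply: contra xZ => /clZ->; apply: AZ.
- by apply: contra yZ => /clZ<-; apply: AZ.
- exact: indA.
Qed.

(** No edge leaves [Z], so the trace of [S] on [Z] can be replaced by [A], which is at least as
    large. *)
Lemma max_independent_swap S A :
  max_independent G S -> max_independent (induced G Z) A ->
  max_independent G (S :\: Z :|: A).
Proof.
case/max_independentP=> indS mS /max_independentP[].
rewrite independent_induced => /andP[indA AZ] mA.
apply/max_independentP; split; first exact: independent_swap.
move=> B /mS leB; apply: leq_trans leB _; rewrite cardsU.
have -> : (S :\: Z) :&: A = set0.
  apply/setP=> x; rewrite !inE; apply/negP=> /andP[/andP[xZ _] /(subsetP AZ)].
  exact/negP.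
rewrite cards0 subn0 -(cardsID Z S) addnC leq_add2l mA //.
by rewrite independent_induced subsetIr (independent_sub (subsetIl _ _) indS).
Qed.

Lemma max_independent_setI S :
  max_independent G S -> max_independent (induced G Z) (S :&: Z).
Proof.
case/max_independentP=> indS mS; apply/max_independentP; split.
  by rewrite independent_induced subsetIr (independent_sub (subsetIl _ _) indS).
move=> A; rewrite independent_induced => /andP[indA AZ].
have := mS _ (independent_swap indS indA AZ); rewrite cardsU.
have -> : (S :\: Z) :&: A = set0.
  apply/setP=> x; rewrite !inE; apply/negP=> /andP[/andP[xZ _] /(subsetP AZ)].
  exact/negP.
by rewrite cards0 subn0 -(cardsID Z S) addnC leq_add2r.
Qed.

End ClosedSets.

(** Serves in place of an equality between graphs obtained by different deletions. *)
Lemma eq_max_independent (T : finType) (G H : graph T) :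
  independent G =1 independent H -> max_independent G =1 max_independent H.
Proof.
move=> eqI S; rewrite /max_independent /alpha eqI.
by under eq_bigl => A do rewrite eqI.
Qed.

Lemma eq_corona (T : finType) (G H : graph T) :
  independent G =1 independent H -> corona G = corona H.
Proof. by move=> /eq_max_independent eqM; apply: eq_bigl. Qed.

Lemma count_odd_iota n : count odd (iota 0 n) = n./2.
Proof. by elim: n => // n IH; rewrite -addn1 iotaD count_cat IH /=; lia. Qed.

Lemma adj_del_edges_sub (T : finType) (G : graph T) (F : {set {set T}}) e x y :
  e \in F -> adj (del_edges G F) x y -> adj (del_edges G [set e]) x y.
Proof.
move=> eF /andP[xy nxy]; rewrite adj_del_edges xy inE.
by apply: contra nxy => /eqP->.
Qed.

(** * The odd cycle with a chosen first vertex *)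

Section RootedCycle.
Variables (T : finType) (G : graph T) (x0 : T) (p : seq T).
Hypothesis Gc : unique_odd_cycle G (x0 :: p).

(* Compare the 2-colourings of the graphs without the edges of c entering and
   leaving x0: their sum is constant along the edges outside c, and takes
   different values at x0 and at the other vertices of c. *)
Lemma cycle_separation x : x \in p ->
  ~~ connect (adj (del_edges G (cycle_edges (x0 :: p)))) x0 x.
Proof.
have [f [fP fc]] := unique_odd_cycle_2coloring Gc.
have [[[/andP[_ uc] _] op] _] := Gc.
have ec0 : [set last x0 p; x0] \in cycle_edges (x0 :: p).
  by apply/imsetP; exists (last x0 p); rewrite ?mem_last // next_last_head.
(* After rotation by one the closing edge is the edge leaving [x0]. *)
have Gc1 := unique_odd_cycle_rot 1 Gc.
have ec1 : cycle_edges (rot 1 (x0 :: p)) = cycle_edges (x0 :: p).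
  by apply: Gc.2; apply: Gc1.1.
case: p => [//|x1 q] in f fP fc uc op ec0 Gc1 ec1 *.
rewrite rot1_cons rcons_cons in Gc1 ec1 *.
have [f' [f'P f'c]] := unique_odd_cycle_2coloring Gc1.
have [[[/andP[_ uc1] _] _] _] := Gc1.
have ec10 : [set last x1 (rcons q x0); x1] \in cycle_edges (x0 :: x1 :: q).
  rewrite -ec1; apply/imsetP; exists (last x1 (rcons q x0)); first exact: mem_last.
  by rewrite next_last_head.
move=> xp; set j := index x (x1 :: q).
have ltj : j < size (x1 :: q) by rewrite index_mem.
have fx : f x = f x0 (+) odd j.+1 by rewrite -fc //= nth_index.
have f'x : f' x = f' x1 (+) odd j.
  rewrite -f'c ?size_rcons 1?ltnW // -rcons_cons nth_rcons ltj.
  by rewrite (set_nth_default x0) // nth_index.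
(* In the rotated cycle [x0] comes last, at the even position [(size q).+1]. *)
have f'x0 : f' x0 = f' x1.
  have := f'c (size q).+1; rewrite size_rcons => /(_ (leqnn _)).
  rewrite /= nth_rcons ltnn eqxx => ->.
  by move: op => /=; case: (odd (size q)) => //=; rewrite addbF.
pose g z := f z (+) f' z.
have clg : closed (adj (del_edges G (cycle_edges [:: x0, x1 & q])))
    [pred z | g z == g x0].
  move=> a b ab; rewrite !inE /g.
  have := fP a b (adj_del_edges_sub ec0 ab); have := f'P a b (adj_del_edges_sub ec10 ab).
  by case: (f a); case: (f b); case: (f' a); case: (f' b).
apply/negP=> /(closed_connect clg); rewrite !inE eqxx /g fx f'x f'x0 /=.
by case: (f x0); case: (f' x1); case: (odd j).
Qed.

(** Take the vertices of C at odd positions. The colouring covers every edge of G, chords included,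
    except the closing one, and that one ends at [x0], which is left out. *)
Lemma cycle_independent : exists I : {set T},
  [/\ independent G I, I \subset cycle_vertices (x0 :: p),
      #|I| = (size (x0 :: p))./2, x0 \notin I & head x0 p \in I].
Proof.
have [f [fP fc]] := unique_odd_cycle_2coloring Gc.
have [[[/andP[cc uc] sc] op] _] := Gc.
exists [set x in x0 :: p | f x != f x0]; split.
- apply/independentP; split.
    by apply/subsetP=> x /setIdP[/(next_cycle cc)/adj_vset].
  move=> x y /setIdP[_ fx] /setIdP[_ fy]; apply/negP=> xy.
  have : adj (del_edges G [set [set last x0 p; x0]]) x y.
    rewrite adj_del_edges xy inE; apply/eqP=> /setP/(_ x0).
    rewrite !inE eqxx orbT => /orP[]/eqP e0; last by rewrite e0 eqxx in fy.
    by rewrite e0 eqxx in fx.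
  by move/fP; case: (f x) (f y) (f x0) fx fy => -[] [].
- by apply/subsetP=> x; rewrite !inE => /andP[].
- rewrite cardsE -count_odd_iota.
  transitivity (count (fun x => f x != f x0) (x0 :: p)).
    rewrite -size_filter -(card_uniqP (filter_uniq _ uc)).
    by apply: eq_card => x; rewrite mem_filter !inE andbC.
  rewrite -{1}[x0 :: p](mkseq_nth x0) count_map.
  apply: eq_in_count => j; rewrite mem_iota => /= ltj; rewrite fc //.
  by case: (f x0); case: (odd j).
- by rewrite !inE !eqxx.
- case: p => [|y q] in sc fc fP *; first by [].
  by rewrite !inE eqxx orbT /=; have := fc 1 isT; rewrite /= => ->; case: (f x0).
Qed.

End RootedCycle.

(** * The graphs D_y attached to the cycle *)

Section AlmostBipartite.
Variables (T : finType) (G : graph T) (c : seq T).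
Hypothesis Gc : unique_odd_cycle G c.
Implicit Types (S A I : {set T}) (s : seq T).

Local Notation G0 := (del_edges G (cycle_edges c)).
Local Notation C := (cycle_vertices c).
Local Notation H := (induced G (~: cycle_vertices c)).

(* The vertex set of D_y. *)
Definition branch (y : T) : {set T} := [set z | connect (adj G0) y z].
Definition punctured_branch (y : T) : {set T} := branch y :\ y.

Lemma cycle_uniq : uniq c.
Proof. exact: ucycle_uniq Gc.1.1.1. Qed.

Lemma cycle_size_gt2 : 2 < size c.
Proof. exact: Gc.1.1.2. Qed.

Lemma cycle_nonempty : exists y, y \in c.
Proof.
by have := cycle_size_gt2; case: c => // y s; exists y; rewrite mem_head.
Qed.

Lemma cycle_vset y : y \in c -> y \in vset G.
Proof. by move/(next_cycle (ucycle_cycle Gc.1.1.1))/adj_vset. Qed.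

Lemma cycle_edges_rot i : cycle_edges (rot i c) = cycle_edges c.
Proof. by apply: Gc.2; apply: (unique_odd_cycle_rot i Gc).1. Qed.

Lemma cycle_edge_mem x y : [set x; y] \in cycle_edges c -> x \in c.
Proof.
case/imsetP=> z zc /set2_eq[[-> _]|[-> _]] //.
by rewrite mem_next.
Qed.

Lemma adj_del_cycle x y : x \notin c -> adj G0 x y = adj G x y.
Proof.
move=> xc; rewrite adj_del_edges; case: (boolP (_ \in _)) => [/cycle_edge_mem|].
  by rewrite (negPf xc).
by rewrite andbT.
Qed.

Lemma connect_del_sym : connect_sym (adj G0).
Proof. by apply: sym_connect_sym; apply: adj_sym. Qed.

Lemma branch_disjoint y z : y \in c -> z \in c -> y != z -> z \notin branch y.
Proof.
move=> yc zc yz; have [i p ep] := rot_to yc; rewrite inE -(cycle_edges_rot i) ep.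
apply: cycle_separation; first by rewrite -ep; apply: unique_odd_cycle_rot.
have : z \in rot i c by rewrite mem_rot.
by rewrite ep inE eq_sym (negPf yz).
Qed.

Lemma punctured_branch_cycle y x : y \in c -> x \in punctured_branch y -> x \notin c.
Proof.
move=> yc /setD1P[xy xY]; apply: contraL xY => xc.
by rewrite branch_disjoint // eq_sym.
Qed.

(** An edge of G with an end off C is not in E(C), hence stays inside D_y. *)
Lemma punctured_branch_adj y x z :
  y \in c -> x \in punctured_branch y -> adj G x z -> z \in branch y.
Proof.
move=> yc xZ xz; have xc := punctured_branch_cycle yc xZ.
case/setD1P: xZ => _; rewrite !inE => /connect_trans; apply.
by rewrite connect1 ?adj_del_cycle.
Qed.

Lemma punctured_branch_nbr y z x :
  y \in c -> z \in c -> y != z -> x \in punctured_branch y -> ~~ adj G z x.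
Proof.
move=> yc zc yz xZ; rewrite adj_sym; apply/negP=> /(punctured_branch_adj yc xZ).
by apply/negP; apply: branch_disjoint.
Qed.

Lemma punctured_branch_disjoint y z x : y \in c -> z \in c ->
  x \in branch y -> x \in punctured_branch z -> y = z.
Proof.
move=> yc zc; rewrite !inE => yx /andP[_ zx]; apply/eqP.
apply: contraT => yz; have := branch_disjoint yc zc yz.
by rewrite inE (connect_trans yx) // connect_del_sym.
Qed.

Lemma closed_punctured_branch y : y \in c -> closed (adj H) (punctured_branch y).
Proof.
move=> yc a b; rewrite adj_induced !in_setC ![_ \in C]inE => /and3P[ac bc ab].
have na z : z \notin c -> z != y by apply: contraNneq => ->.
apply/idP/idP=> /punctured_branch_adj.
  by move=> /(_ b yc ab) bY; rewrite in_setD1 na.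
by rewrite adj_sym in ab; move=> /(_ a yc ab) bY; rewrite in_setD1 na.
Qed.

(** With [y] as first vertex, the closing edge ends at [y] and is absent from the induced graph. *)
Lemma bipartite_avoid A y : y \in c -> y \notin A -> bipartite (induced G A).
Proof.
move=> yc yA; have [i p ep] := rot_to yc.
have Gp : unique_odd_cycle G (y :: p) by rewrite -ep; apply: unique_odd_cycle_rot.
have [f [fP _]] := unique_odd_cycle_2coloring Gp.
exists f => a b /and3P[aA bA ab]; apply: fP; rewrite adj_del_edges ab inE.
apply/eqP=> /setP/(_ y); rewrite !inE eqxx orbT => /orP[]/eqP e.
  by rewrite e aA in yA.
by rewrite e bA in yA.
Qed.

Lemma bipartite_branch y : y \in c -> bipartite (induced G (branch y)).
Proof.
move=> yc; have [z zc zy] : exists2 z, z \in c & z != y.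
  exists (next c y); rewrite ?mem_next //.
  have := next_cycle (ucycle_cycle Gc.1.1.1) yc.
  by apply: contraTneq => ->; rewrite adj_irr.
by apply: (bipartite_avoid zc); rewrite branch_disjoint // eq_sym.
Qed.

Lemma bipartite_off_cycle : bipartite H.
Proof.
by have [y yc] := cycle_nonempty; apply: (bipartite_avoid yc); rewrite !inE yc.
Qed.

(** * Maximum independent sets in the non-König-Egerváry case *)

Section NonKonigEgervary.
Hypothesis GnKE : ~ konig_egervary G.

(* Otherwise alpha(D_y - y) + mu(D_y) >= |D_y|, and as no edge joins D_y - y to
   the vertices outside D_y, adding Konig's equality for G - D_y yields
   alpha(G) + mu(G) >= n(G). *)
Lemma alpha_branch y : y \in c ->
  alpha (induced G (punctured_branch y)) < alpha (induced G (branch y)).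
Proof.
move=> yc; rewrite ltnNge; apply/negP=> leYZ; apply: GnKE.
have kY := konig (bipartite_branch yc).
have yY : y \in branch y by rewrite inE connect0.
have kW := konig (@bipartite_avoid (~: branch y) y yc _).
rewrite inE yY in kW; have {}kW := kW isT.
have muG : mu (induced G (branch y)) + mu (induced G (~: branch y)) <= mu G.
  by apply: mu_disjoint; rewrite disjoints_subset setCK.
have oG : order_of (induced G (branch y)) + order_of (induced G (~: branch y))
    = order_of G by rewrite /order_of !vset_induced -setDE cardsID.
have aG : alpha (induced G (punctured_branch y)) + alpha (induced G (~: branch y))
    <= alpha G.
  have [S /andP[]] := max_independent_exists (induced G (punctured_branch y)).
  rewrite independent_induced => /andP[/independentP[SV indS] /subsetP SZ] /eqP <-.
  have [A /andP[]] := max_independent_exists (induced G (~: branch y)).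
  rewrite independent_induced => /andP[/independentP[AV indA] /subsetP AW] /eqP <-.
  have SA0 : S :&: A = set0.
    apply/setP=> x; rewrite !inE; apply/negP=> /andP[/SZ/setD1P[_ xY] /AW].
    by rewrite inE xY.
  have noSA x z : x \in S -> z \in A -> ~~ adj G x z.
    move=> /SZ xZ /AW; rewrite in_setC; apply: contra.
    exact: punctured_branch_adj.
  rewrite -[leqLHS]subn0 -(cards0 T) -SA0 -cardsU; apply: leq_alpha.
  apply/independentP; split=> [|x z]; first by rewrite subUset SV.
  case/setUP=> [xS|xA] /setUP[zS|zA]; [exact: indS|exact: noSA| |exact: indA].
  by rewrite adj_sym noSA.
apply/eqP; rewrite eqn_leq alpha_mu_leq; lia.
Qed.

(** By [alpha_branch], a maximum independent set of D_y must contain [y]; removing [y] leaves a set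
    that avoids its neighbours and is still large enough for D_y - y. *)
Lemma max_independent_branch y : y \in c ->
  exists2 S, max_independent (induced G (punctured_branch y)) S &
             {in S, forall x, ~~ adj G y x}.
Proof.
move=> yc; have := alpha_branch yc.
have [S /andP[]] := max_independent_exists (induced G (branch y)).
rewrite independent_induced => /andP[indS SY] /eqP <- ltS.
have yS : y \in S.
  apply: contraLR ltS => yS; rewrite -leqNgt; apply: leq_alpha.
  by rewrite independent_induced indS subsetD1 SY.
exists (S :\ y) => [|x /setD1P[_ xS]]; last first.
  by case/independentP: indS => _; apply.
have indSy : independent (induced G (punctured_branch y)) (S :\ y).
  rewrite independent_induced (independent_sub (subsetDl _ _) indS).
  exact: setSD.
have := leq_alpha indSy; rewrite /max_independent indSy eqn_leq => ->.
by rewrite (cardsD1 y) yS in ltS.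
Qed.

Lemma independent_punctured_branch y : y \in c ->
  independent (induced H (punctured_branch y)) =1
  independent (induced G (punctured_branch y)).
Proof.
move=> yc S; rewrite !independent_induced -andbA; congr (_ && _).
apply/andb_idl => SZ; apply/subsetP=> x /(subsetP SZ) xZ.
by rewrite !inE (punctured_branch_cycle yc xZ).
Qed.

(** For each [y] in [s], the part in D_y - y is exchanged for the set of [max_independent_branch].
    All neighbours of [y] off C lie in D_y - y, and the new part has no neighbour on C other than
    possibly [y], so earlier exchanges are not spoiled. *)
Lemma max_independent_avoiding s S : {subset s <= c} -> max_independent H S ->
  exists A, [/\ max_independent H A,
    forall y x, y \in s -> x \in A -> ~~ adj G y x &
    {in S, forall x, (forall y, y \in s -> x \notin punctured_branch y) -> x \in A}].
Proof.
elim: s => [|y s IH] sc mS; first by exists S; split.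
have yc : y \in c by apply: sc; rewrite mem_head.
have sc' : {subset s <= c} by move=> z zs; apply: sc; rewrite inE zs orbT.
have [B [mB sB SB]] := IH sc' mS.
have [A mA yA] := max_independent_branch yc.
have AZ : A \subset punctured_branch y.
  by case/andP: mA; rewrite independent_induced => /andP[].
exists (B :\: punctured_branch y :|: A); split.
- apply: max_independent_swap => //; first exact: closed_punctured_branch.
  by rewrite (eq_max_independent (independent_punctured_branch yc)).
- move=> z x zs /setUP[/setDP[xB xZ]|xA]; last first.
    case: (eqVneq z y) => [->|zy]; first exact: yA.
    apply: (punctured_branch_nbr yc) (subsetP AZ x xA); first exact: sc.
    by rewrite eq_sym.
  move: zs; rewrite inE => /orP[/eqP->|zs]; last exact: sB.
  apply: contra xZ => yx.
  have xc : x \notin c.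
    case/max_independentP: mB; rewrite independent_induced => /andP[_ /subsetP/(_ x xB)].
    by rewrite !inE.
  rewrite in_setD1; apply/andP; split; first by apply: contraNneq xc => ->.
  by rewrite inE connect1 // adj_sym adj_del_cycle // adj_sym.
move=> x xS xs; apply/setUP; left; apply/setDP; split;
  last by apply: xs; rewrite mem_head.
apply: SB => // z zs.
by apply: xs; rewrite inE zs orbT.
Qed.

(** The successors along C of the vertices of [S :&: C] are equally many and lie outside [S]. *)
Lemma independent_cycle_leq S : independent G S -> #|S :&: C| <= (size c)./2.
Proof.
case/independentP=> _ indS; have cG := ucycle_cycle Gc.1.1.1.
have : #|S :&: C :|: next c @: (S :&: C)| <= size c.
  rewrite -(card_uniqP cycle_uniq); apply/subset_leq_card/subsetP=> x.
  case/setUP => [/setIP[_]|/imsetP[y /setIP[_]]]; rewrite inE // => yc ->.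
  by rewrite mem_next.
rewrite cardsU.
have -> : (S :&: C) :&: (next c @: (S :&: C)) = set0.
  apply/setP=> x; rewrite in_set0; apply/negP=> /setIP[/setIP[xS _]].
  case/imsetP=> y /setIP[yS yC] exy; rewrite inE in yC.
  by have := indS y x yS xS; rewrite exy next_cycle.
rewrite cards0 subn0 card_imset; last exact: can_inj (prev_next cycle_uniq).
lia.
Qed.

Lemma independent_off_cycle S : independent G S -> independent H (S :\: C).
Proof.
move=> indS; rewrite independent_induced (independent_sub (subsetDl _ _) indS).
by rewrite setDE subsetIr.
Qed.

(** The upper bounds on C and off C are attained simultaneously. *)
Lemma max_independent_extend I S : independent G I -> I \subset C ->
  #|I| = (size c)./2 -> max_independent H S ->
  (forall y x, y \in I -> x \in S -> ~~ adj G y x) ->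
  max_independent G (I :|: S).
Proof.
move=> /independentP[IV indI] IC cI /max_independentP[].
rewrite independent_induced => /andP[/independentP[SV indS] /subsetP SC] mS IS.
apply/max_independentP; split.
  apply/independentP; split=> [|x z]; first by rewrite subUset IV.
  case/setUP=> [xI|xS] /setUP[zI|zS]; [exact: indI|exact: IS| |exact: indS].
  by rewrite adj_sym IS.
move=> A indA; rewrite -(cardsID C A) cardsU.
have -> : I :&: S = set0.
  apply/setP=> x; rewrite in_set0; apply/negP=> /setIP[/(subsetP IC) xC /SC].
  by rewrite inE xC.
rewrite cards0 subn0 leq_add ?cI ?independent_cycle_leq //.
by apply: mS; apply: independent_off_cycle.
Qed.

Lemma cycle_independent_notin y : y \in c -> exists I,
  [/\ independent G I, I \subset C, #|I| = (size c)./2 & y \notin I].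
Proof.
move=> yc; have [i p ep] := rot_to yc.
have [I [indI IC cI yI _]] : exists I : {set T},
    [/\ independent G I, I \subset cycle_vertices (y :: p),
      #|I| = (size (y :: p))./2, y \notin I & head y p \in I].
  by apply: cycle_independent; rewrite -ep; apply: unique_odd_cycle_rot.
exists I; split=> //; last by rewrite cI -ep size_rot.
by apply: subset_trans IC _; rewrite -ep; apply/subsetP=> x; rewrite !inE mem_rot.
Qed.

Lemma cycle_independent_in y : y \in c -> exists I,
  [/\ independent G I, I \subset C, #|I| = (size c)./2 & y \in I].
Proof.
move=> yc; have [i p ep] := rot_to yc.
have : 2 < size (rot i c) by rewrite size_rot cycle_size_gt2.
have Gp := unique_odd_cycle_rot i Gc.
rewrite ep; case/lastP: p ep => // p z ep _.
(* A second rotation puts the predecessor [z] of [y] first, so that [y] is the second vertex, which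
   [cycle_independent] selects. *)
have ez : rot (size p).+1 (rot i c) = z :: y :: p.
  by rewrite ep -rcons_cons -cats1 -[(size p).+1]/(size (y :: p)) rot_size_cat.
have Gz := unique_odd_cycle_rot (size p).+1 Gp.
rewrite ez in Gz; have [I [indI IC cI _ yI]] := cycle_independent Gz.
exists I; split=> //; last by rewrite cI -ez !size_rot.
by apply: subset_trans IC _; rewrite -ez; apply/subsetP=> x; rewrite !inE !mem_rot.
Qed.

Lemma cycle_sub_corona : C \subset corona G.
Proof.
apply/subsetP=> y; rewrite inE => yc; have [S mS] := max_independent_exists H.
have [B [mB cB _]] := max_independent_avoiding (fun x xc => xc) mS.
have [I [indI IC cI yI]] := cycle_independent_in yc.
apply/coronaP; exists (I :|: B); last by rewrite inE yI.
by apply: max_independent_extend => // z x /(subsetP IC); rewrite inE; apply: cB.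
Qed.

(** Some [I :|: B] has k + [alpha H] vertices, and [S] has at most k on C, so at least [alpha H] of
    its vertices are off C. *)
Lemma max_independent_off_cycle S :
  max_independent G S -> max_independent H (S :\: C).
Proof.
case/max_independentP=> indS mS.
have [A mA] := max_independent_exists H.
have [B [mB cB _]] := max_independent_avoiding (fun x xc => xc) mA.
have [y yc] := cycle_nonempty.
have [I [indI IC cI _]] := cycle_independent_in yc.
have mIB : max_independent G (I :|: B).
  apply: max_independent_extend => // z x /(subsetP IC).
  by rewrite inE; apply: cB.
have indSC := independent_off_cycle indS.
rewrite /max_independent indSC eqn_leq leq_alpha //=.
case/andP: mB => indB /eqP <-.
have := independent_cycle_leq indS.
have := mS _ (andP mIB).1; rewrite cardsU.
have -> : I :&: B = set0.
  apply/setP=> x; rewrite in_set0; apply/negP=> /setIP[/(subsetP IC) xC].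
  move: indB; rewrite independent_induced => /andP[_ /subsetP BC] /BC.
  by rewrite inE xC.
by rewrite cards0 subn0 cI -(cardsID C S); lia.
Qed.

Lemma core_off_cycle : core H \subset core G.
Proof.
apply/subsetP=> x /coreP xH; apply/coreP=> S /max_independent_off_cycle/xH.
by case/setDP.
Qed.

Lemma corona_off_cycle : corona G = C :|: corona H.
Proof.
apply/setP=> v; apply/idP/idP=> [/coronaP[S mS vS]|/setUP[]].
- case: (boolP (v \in C)) => vC; first by rewrite inE vC.
  apply/setUP; right; apply/coronaP; exists (S :\: C).
    exact: max_independent_off_cycle.
  by rewrite inE vC.
- exact: subsetP cycle_sub_corona v.
case/coronaP=> S mS vS.
(* At most one D_y - y contains [v]. It is left untouched by choosing the vertices on C without [y]
   and rearranging only the other branches. If none contains [v], any [y] will do. *)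
have [y yc yv] : exists2 y, y \in c &
    forall z, z \in c -> z != y -> v \notin punctured_branch z.
  case: (boolP (has (fun y => v \in punctured_branch y) c)) => [/hasP[y yc vy]|].
    exists y => // z zc; apply: contra => vz; apply/eqP.
    by apply: punctured_branch_disjoint vy; rewrite //; case/setD1P: vz.
  move/hasPn=> nv; have [y yc] := cycle_nonempty.
  by exists y => // z /nv.
have [|B [mB cB SB]] := @max_independent_avoiding [seq z <- c | z != y] S _ mS.
  by move=> z; rewrite mem_filter => /andP[].
have [I [indI IC cI yI]] := cycle_independent_notin yc.
apply/coronaP; exists (I :|: B).
  apply: max_independent_extend => // z x zI; apply: cB.
  have := subsetP IC z zI; rewrite inE mem_filter => ->; rewrite andbT.
  by apply: contraNneq yI => <-.
by rewrite inE SB ?orbT // => z; rewrite mem_filter => /andP[zy zc]; apply: yv.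
Qed.

Lemma corona_core_cover : corona G :|: nbh G (core G) = vset G.
Proof.
apply/setP=> v; apply/idP/idP=> [/setUP[/coronaP[S /andP[/independentP[SV _] _]]|]|vG].
- exact: subsetP.
- by case/nbhP=> u _; rewrite adj_sym => /adj_vset.
rewrite inE corona_off_cycle; case: (boolP (v \in C)) => vC; first by rewrite inE vC.
case: (boolP (v \in corona H)) => vH; first by rewrite inE vH orbT.
have vVH : v \in vset H by rewrite vset_induced in_setI vG in_setC.
have [u uH /and3P[_ _ uv]] := bipartite_corona bipartite_off_cycle vVH vH.
apply/orP; right; apply/nbhP; exists u => //; exact: subsetP core_off_cycle u uH.
Qed.

(** The union of the D_y is closed under adjacency: an edge of C ends on C, and any other edge stays
    in one D_y. *)
Lemma connected_branch v : connected G -> v \in vset G ->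
  exists2 y, y \in c & v \in branch y.
Proof.
move=> cG vG; have [y yc] := cycle_nonempty.
have clU : closed (adj G) [pred x | has (fun y => x \in branch y) c].
  apply: intro_closed; first by apply: sym_connect_sym; apply: adj_sym.
  move=> a b ab /hasP[z zc az]; apply/hasP.
  case: (boolP ([set a; b] \in cycle_edges c)) => abc.
    exists b; last by rewrite inE connect0.
    by rewrite setUC in abc; apply: cycle_edge_mem abc.
  exists z => //; rewrite !inE in az *; apply: connect_trans az (connect1 _).
  by rewrite adj_del_edges ab.
have := closed_connect clU (cG y v (cycle_vset yc) vG); rewrite !inE.
have -> : has (fun z => y \in branch z) c.
  by apply/hasP; exists y; rewrite // inE connect0.
by move/esym/hasP.
Qed.

(** The sets D_y - y cover H and are unions of its components, so maximum independent sets restrict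
    to each of them and can be exchanged there. *)
Lemma corona_branches : connected G ->
  corona H = \bigcup_(y in C) corona (induced G (punctured_branch y)).
Proof.
move=> cG; apply/setP=> v; apply/coronaP/bigcupP=> [[S mS vS]|[y]]; last first.
  rewrite inE => yc /coronaP[A mA vA]; have [S mS] := max_independent_exists H.
  exists (S :\: punctured_branch y :|: A); last by rewrite inE vA orbT.
  apply: max_independent_swap => //; first exact: closed_punctured_branch.
  by rewrite (eq_max_independent (independent_punctured_branch yc)).
case/max_independentP: (mS); rewrite independent_induced => /andP[] /independentP[SV _].
move=> /subsetP/(_ v vS); rewrite !inE => vc _.
have [y yc vy] := connected_branch cG (subsetP SV v vS).
have vZ : v \in punctured_branch y.
  by rewrite in_setD1 vy andbT; apply: contraNneq vc => ->.
exists y; first by rewrite inE.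
apply/coronaP; exists (S :&: punctured_branch y); last by rewrite inE vS.
rewrite -(eq_max_independent (independent_punctured_branch yc)).
by apply: max_independent_setI => //; apply: closed_punctured_branch.
Qed.

(** D_y - y avoids C, so deleting E(C) does not change the adjacency inside it. *)
Lemma corona_D_comp y : y \in c ->
  corona (del_vertex (D_comp G c y) y) = corona (induced G (punctured_branch y)).
Proof.
move=> yc; apply: eq_corona => S; rewrite !independent_induced -andbA.
rewrite -subsetI -setDE -/(branch y) -/(punctured_branch y).
apply/andP/andP=> -[/independentP[SV indS] SZ]; split=> //; apply/independentP.
  split=> // x z xS zS; have := indS x z xS zS; rewrite adj_del_cycle //.
  exact: punctured_branch_cycle yc (subsetP SZ x xS).
split=> // x z xS zS; rewrite adj_del_cycle ?indS //.
exact: punctured_branch_cycle yc (subsetP SZ x xS).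
Qed.

End NonKonigEgervary.
End AlmostBipartite.

Theorem theorem2p15 (T : finType) (G : graph T) (c : seq T)
    (Gc : unique_odd_cycle G c) (GnKE : ~ konig_egervary G) :
  corona G :|: nbh G (core G) = vset G /\
  (connected G ->
     corona G = cycle_vertices c :|:
       \bigcup_(y in cycle_vertices c) corona (del_vertex (D_comp G c y) y)).
Proof.
split=> [|cG]; first exact: corona_core_cover Gc GnKE.
rewrite (corona_off_cycle Gc GnKE) (corona_branches Gc cG); congr (_ :|: _).
by apply: eq_bigr => y; rewrite inE => yc; rewrite corona_D_comp.
Qed.
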